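(* Let $R$ be a Noetherian commutative ring with identity. Let $\mu_1,\dots,\mu_u,\nu_1,\dots,\nu_v$ be elements of $R$ and consider the ideals $I=(\mu_1,\dots,\mu_u)$ and $J=(\nu_1,\dots,\nu_v)$ of $R$. Suppose that there is a positive integer $s$ with $s<u$ and $s\leq v$ such that $[\mu_1,\dots,\mu_s]\subset[\nu_1,\dots,\nu_s]$. Set $$r=\begin{cases}u+v-s-1 & \text{if } s\leq v-2,\\ u & \text{if } v-1\leq s\leq v.\end{cases}$$ Then $\operatorname{ara}(I\cap J)\leq r$. Moreover, there are elements $\gamma_1,\dots,\gamma_r\in R$ generating $I\cap J$ up to radical such that $$[\gamma_1,\dots,\gamma_u]\subset[\mu_{s+1},\dots,\mu_u,\mu_1,\dots,\mu_s]$$ and $$[\gamma_1,\dots,\gamma_v]\subset[\nu_1,\dots,\nu_v].$$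
   Context: Elements $\gamma_1,\dots,\gamma_r\in R$ generate an ideal $I$ of $R$ up to radical if $\sqrt{I}=\sqrt{(\gamma_1,\dots,\gamma_r)}$. The smallest $r$ for which such elements exist is the arithmetical rank of $I$, denoted $\operatorname{ara} I$. For elements $\alpha_1,\dots,\alpha_t,\beta_1,\dots,\beta_t\in R$, one writes $[\alpha_1,\dots,\alpha_t]\subset[\beta_1,\dots,\beta_t]$ if, for all indices $i$ with $1\leq i\leq t$, there is an inclusion of ideals $(\alpha_1,\dots,\alpha_i)\subset(\beta_1,\dots,\beta_i)$ (not necessarily strict). *)

(* Defs.v *)
(* Ideals are Prop-valued sets ([set R]), so no membership test is assumed. *)
From HB Require Import structures.
From mathcomp Require Import all_boot all_order all_algebra.
From mathcomp Require Import boolp classical_sets.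

Set Implicit Arguments.
Unset Strict Implicit.
Unset Printing Implicit Defensive.

Import GRing.Theory.

Local Open Scope classical_set_scope.
Local Open Scope ring_scope.

Section Ideals.
Variable R : comPzRingType.
Implicit Types (I : set R) (s a b : seq R) (r : nat).

(* Not necessarily proper, unlike the library's [idealr_closed]. *)
Definition is_ideal I : Prop :=
  [/\ I 0, (forall x y, I x -> I y -> I (x + y))
    & (forall c x, I x -> I (c * x))].

Definition ideal_gen s : set R :=
  [set x | exists c : 'I_(size s) -> R, x = \sum_(i < size s) c i * s`_i].

Definition noetherian : Prop :=
  forall I, is_ideal I -> exists s, I = ideal_gen s.

Definition radical I : set R :=
  [set x | exists2 n, (0 < n)%N & I (x ^+ n)].

Definition gen_up_to_radical s I : Prop :=
  radical I = radical (ideal_gen s).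

(* "[r] is the arithmetical rank of [I]"; there is at most one such [r]. *)
Definition is_ara I r : Prop :=
  (exists g : r.-tuple R, gen_up_to_radical g I) /\
  (forall n, (exists g : n.-tuple R, gen_up_to_radical g I) -> (r <= n)%N).

(* [a_1, ..., a_t] \subset [b_1, ..., b_t], which is meaningful only for
   sequences of the same length t: the equality of lengths is part of it. *)
Definition bracket_sub a b : Prop :=
  size a = size b /\
  forall i, (1 <= i <= size b)%N ->
    ideal_gen (take i a) `<=` ideal_gen (take i b).

End Ideals.

Arguments noetherian R : clear implicits.

(* Main.v *)
Require Import Defs.
From mathcomp Require Import all_boot all_order all_algebra.
From mathcomp Require Import boolp classical_sets.
From mathcomp Require Import zify.

(** Split the generators of [I] as [a = (mu_1, ..., mu_s)] and
    [b = (mu_(s+1), ..., mu_u)], and write [m] for the length of [b]. Since [a]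
    lies in [J], the ideals [I `&` J] and [(a) + (b) J] have the same radical.
    The products [b_i nu_j] are generated up to radical by their antidiagonal
    sums, [m + v - 1] in number (the method of Schmitt and Vogel). The elements
    of [a] cost nothing more: [a_k] is added to the [m + k]-th antidiagonal sum,
    and the resulting sequence [gamma] is long enough to hold both families as
    soon as it has [max (m + v - 1) (m + s)] terms, which is the number [r].

    Adding [a_k] that late does no harm. Let [K] be the radical of [(gamma)].
    By induction on [i], then on [j], each [b_i nu_j] is in [K]: in
    [b_i * gamma_(i+j-1)] the terms other than [b_i ^ 2 nu_j] involve either an
    earlier [b], or [b_i] and an earlier [nu], or [b_i a_(i+j-1-m)]; the last one
    is harmless because [i <= m] puts [a_(i+j-1-m)] in [(nu_1, ..., nu_(j-1))],
    by the hypothesis on flags ([mul_in_radical]). Once the products are in [K],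
    so is each [a_k] ([add_in_radical]), and [x ^+ 2] is in [(a) + (b) J] for [x]
    in [I `&` J] ([gen_up_to_radical_gammas]). Both flag inclusions can be read
    off the formula for [gamma_k] ([gammas_in_right], [gammas_in_left]). *)

Set Implicit Arguments.
Unset Strict Implicit.
Unset Printing Implicit Defensive.

Import GRing.Theory.

Local Open Scope classical_set_scope.
Local Open Scope ring_scope.

(** * Ideals, generators and radicals *)

Section IdealTheory.
Variable R : comPzRingType.
Implicit Types (I : set R) (s t : seq R).

Lemma ideal_sum I (T : Type) (l : seq T) (P : pred T) (F : T -> R) :
  is_ideal I -> (forall i, P i -> I (F i)) -> I (\sum_(i <- l | P i) F i).
Proof. by case=> I0 ID _ IF; apply: (big_ind I). Qed.

Lemma ideal_mulr I c x : is_ideal I -> I x -> I (x * c).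
Proof. by case=> _ _ IM Ix; rewrite mulrC; apply: IM. Qed.

Lemma ideal_subr I x y : is_ideal I -> I (x + y) -> I y -> I x.
Proof.
case=> _ ID IM Ixy Iy; rewrite -(addrK y x) -mulN1r.
by apply: ID => //; apply: IM.
Qed.

Lemma is_ideal_gen s : is_ideal (ideal_gen s).
Proof.
split.
- by exists (fun=> 0); rewrite big1 // => i _; rewrite mul0r.
- move=> _ _ [c ->] [d ->]; exists (fun i => c i + d i).
  by rewrite -big_split; apply: eq_bigr => i _; rewrite mulrDl.
- move=> e _ [c ->]; exists (fun i => e * c i).
  by rewrite mulr_sumr; apply: eq_bigr => i _; rewrite mulrA.
Qed.

Lemma is_ideal_setI I J : is_ideal I -> is_ideal J -> is_ideal (I `&` J).
Proof.
move=> [I0 ID IM] [J0 JD JM]; split=> //.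
- by move=> x y [Ix Jx] [Iy Jy]; split; [apply: ID | apply: JD].
- by move=> c x [Ix Jx]; split; [apply: IM | apply: JM].
Qed.

Lemma is_ideal_colon I c : is_ideal I -> is_ideal [set x | I (c * x)].
Proof.
move=> [I0 ID IM]; split=> /=; first by rewrite mulr0.
- by move=> x y Ix Iy; rewrite mulrDr; apply: ID.
- by move=> d x Ix; rewrite mulrCA; apply: IM.
Qed.

Lemma ideal_gen_nth s i : ideal_gen s s`_i.
Proof.
have [ltis | leis] := ltnP i (size s); last first.
  by rewrite nth_default //; case: (is_ideal_gen s).
exists (fun k => (k == Ordinal ltis)%:R).
rewrite (bigD1 (Ordinal ltis)) //= eqxx mul1r big1 ?addr0 // => k /negPf->.
by rewrite mul0r.
Qed.

Lemma ideal_gen_sub s I :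
  is_ideal I -> (forall i, (i < size s)%N -> I s`_i) -> ideal_gen s `<=` I.
Proof.
move=> idI Is _ [c ->]; apply: ideal_sum => // i _.
by case: idI => _ _; apply; apply: Is.
Qed.

Lemma ideal_gen_subset s t : {subset s <= t} -> ideal_gen s `<=` ideal_gen t.
Proof.
move=> st; apply: ideal_gen_sub; first exact: is_ideal_gen.
by move=> i /(mem_nth 0)/st /(nthP 0)[j _ <-]; apply: ideal_gen_nth.
Qed.

Lemma ideal_gen_take_nth s i k : (i < k)%N -> ideal_gen (take k s) s`_i.
Proof. by move=> ltik; rewrite -(nth_take 0 ltik); apply: ideal_gen_nth. Qed.

Lemma ideal_gen_take_le s i j :
  (i <= j)%N -> ideal_gen (take i s) `<=` ideal_gen (take j s).
Proof.
move=> leij; apply: ideal_gen_sub; first exact: is_ideal_gen.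
move=> k; rewrite size_take_min leq_min => /andP[ltki _]; rewrite nth_take //.
exact: ideal_gen_take_nth (leq_trans ltki leij).
Qed.

Lemma bracket_subP s t :
  size s = size t ->
  (forall k, (k < size t)%N -> ideal_gen (take k.+1 t) s`_k) ->
  bracket_sub s t.
Proof.
move=> eq_sz st; split=> // i /andP[_ leit].
apply: ideal_gen_sub; first exact: is_ideal_gen.
move=> k; rewrite size_take_min leq_min eq_sz => /andP[ltki ltkt].
by rewrite nth_take //; apply: ideal_gen_take_le ltki _ (st _ ltkt).
Qed.

Lemma is_ideal_radical I : is_ideal I -> is_ideal (radical I).
Proof.
move=> idI; have [I0 ID IM] := idI; split.
- by exists 1%N => //; rewrite expr1.
- move=> x y [p p0 Ixp] [q q0 Iyq]; exists (p + q)%N; first by rewrite addn_gt0 p0.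
  rewrite exprDn; apply: ideal_sum => // i _; rewrite -mulr_natr.
  apply: ideal_mulr => //.
  (* x occurs to the power p + q - i: either that is at least p, or i >= q. *)
  have [leqi | /ltnW leiq] := leqP q i.
    by apply: (IM); rewrite -(subnK leqi) exprD; apply: IM.
  apply: ideal_mulr => //; rewrite -addnBA // addnC exprD; exact: IM.
- by move=> c x [p p0 Ixp]; exists p => //; rewrite exprMn; apply: IM.
Qed.

Lemma sub_radical I : I `<=` radical I.
Proof. by move=> x Ix; exists 1%N. Qed.

Lemma radical_exp I x n : (0 < n)%N -> radical I (x ^+ n) -> radical I x.
Proof.
by move=> n0 [p p0 Ip]; exists (n * p)%N; rewrite ?muln_gt0 ?n0 // exprM.
Qed.

Lemma gen_up_to_radicalP s I :
  ideal_gen s `<=` I -> I `<=` radical (ideal_gen s) -> gen_up_to_radical s I.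
Proof.
move=> sI Is; apply/seteqP; split=> x [n n0 Ixn].
  exact: radical_exp n0 (Is _ Ixn).
by exists n => //; apply: sI.
Qed.

Lemma ara_le I r (g : r.-tuple R) :
  gen_up_to_radical g I -> exists2 a, is_ara I a & (a <= r)%N.
Proof.
move=> gI; pose P n := `[< exists g : n.-tuple R, gen_up_to_radical g I >].
have exP : exists n, P n by exists r; apply/asboolP; exists g.
case: (ex_minnP exP) => a /asboolP Pa min_a; exists a; last first.
  by apply: min_a; apply/asboolP; exists g.
by split=> // n Pn; apply: min_a; apply/asboolP.
Qed.

End IdealTheory.

(** * Antidiagonal sums with extra generators *)

Section Antidiagonals.
Variable R : comPzRingType.
Variables a b nu : seq R.

(** Indices start at 0, so the antidiagonal is [i + j = k]. Entries out of range
    are 0, whence the sums need no bounds on [i] and [j]. *)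
Definition gamma_at k : R :=
  \sum_(i < k.+1) b`_i * nu`_(k - i) +
  (if (size b <= k)%N then a`_(k - size b) else 0).

Definition gammas r : seq R := mkseq gamma_at r.

Hypothesis a_nu : forall j, ideal_gen (take j.+1 nu) a`_j.

Lemma gammas_in_right k : ideal_gen (take k.+1 nu) (gamma_at k).
Proof.
have idN := is_ideal_gen (take k.+1 nu); have [N0 ND NM] := idN; apply: ND.
  apply: ideal_sum => // i _; apply: NM; apply: ideal_gen_take_nth.
  by rewrite ltnS leq_subr.
case: ifP => // _; apply: ideal_gen_take_le (a_nu _).
by rewrite ltnS leq_subr.
Qed.

Lemma gammas_in_left k : ideal_gen (take k.+1 (b ++ a)) (gamma_at k).
Proof.
have idM := is_ideal_gen (take k.+1 (b ++ a)); have [M0 MD _] := idM; apply: MD.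
  apply: ideal_sum => // i _; apply: ideal_mulr => //.
  have [ltib | leib] := ltnP i (size b); last by rewrite nth_default.
  have -> : b`_i = (b ++ a)`_i by rewrite nth_cat ltib.
  exact: ideal_gen_take_nth.
case: ifP => // lebk.
have -> : a`_(k - size b) = (b ++ a)`_k by rewrite nth_cat ltnNge lebk.
exact: ideal_gen_take_nth.
Qed.

Variable r : nat.
Hypothesis products_fit : (size b + size nu <= r.+1)%N.
Hypothesis additions_fit : (size b + size a <= r)%N.

Let K := radical (ideal_gen (gammas r)).

Let idK : is_ideal K.
Proof. exact/is_ideal_radical/is_ideal_gen. Qed.

Lemma gamma_in_radical k : (k < r)%N -> K (gamma_at k).
Proof.
move=> ltkr; apply: sub_radical; rewrite -(nth_mkseq 0 _ ltkr).
exact: ideal_gen_nth.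
Qed.

(** Multiplying the antidiagonal sum through [b_i nu_j] by [b_i] isolates
    [b_i ^ 2 nu_j] modulo products that come earlier in the lexicographic order,
    and a radical ideal containing [b_i ^ 2 nu_j] contains [b_i nu_j]. *)
Lemma mul_in_radical i j : K (b`_i * nu`_j).
Proof.
have [K0 KD KM] := idK.
elim/ltn_ind: i j => i IHi; elim/ltn_ind=> j IHj.
have [leib | ltib] := leqP (size b) i; first by rewrite nth_default // mul0r.
have [lejn | ltjn] := leqP (size nu) j; first by rewrite [nu`_j]nth_default // mulr0.
have ltijr : (i + j < r)%N.
  by rewrite -ltnS; apply: leq_trans products_fit; rewrite -addnS -addSn leq_add.
have ltii : (i < (i + j).+1)%N by rewrite ltnS leq_addr.
have := KM b`_i _ (gamma_in_radical ltijr).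
rewrite /gamma_at (bigD1 (Ordinal ltii)) //= addKn -addrA mulrDr => Ksum.
apply: (@radical_exp _ _ _ 2) => //; rewrite expr2 mulrA [_ * b`_i]mulrC.
apply: ideal_mulr => //.
apply: ideal_subr Ksum _ => //; rewrite mulrDr; apply: (KD).
  rewrite mulr_sumr; apply: ideal_sum => // l neq_li.
  have [ltli | leil] := ltnP l i; first by apply: KM; apply: IHi.
  have ltil : (i < l)%N by rewrite ltn_neqAle eq_sym leil andbT.
  rewrite mulrCA; apply: KM; apply: IHj.
  by rewrite ltn_subLR ?ltn_add2r // -ltnS.
case: ifP => [leb | _]; last by rewrite mulr0.
(* As i < size b, the index of the added entry of a is smaller than j. *)
have lt_j : (i + j - size b < j)%N by rewrite ltn_subLR ?ltn_add2r.
apply: (ideal_gen_sub (is_ideal_colon b`_i idK)) (a_nu _) => l.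
rewrite size_take_min leq_min => /andP[ltl _] /=; rewrite nth_take //.
by apply: IHj; apply: leq_trans lt_j.
Qed.

Lemma add_in_radical j : K a`_j.
Proof.
have [leaj | ltja] := leqP (size a) j.
  by rewrite nth_default //; case: idK.
have ltr : (size b + j < r)%N.
  by apply: leq_trans additions_fit; rewrite ltn_add2l.
have := gamma_in_radical ltr; rewrite /gamma_at leq_addr addKn addrC.
move=> Ksum; apply: ideal_subr Ksum _ => //.
by apply: ideal_sum => // i _; apply: mul_in_radical.
Qed.

(** For [x] in both ideals, write [x] in terms of [a ++ b] in one factor of
    [x * x] and in terms of [nu] in the other. *)
Lemma gen_up_to_radical_gammas :
  gen_up_to_radical (gammas r) (ideal_gen (a ++ b) `&` ideal_gen nu).
Proof.
apply: gen_up_to_radicalP.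
  apply: ideal_gen_sub; first by apply: is_ideal_setI; apply: is_ideal_gen.
  move=> k; rewrite size_mkseq => ltkr; rewrite nth_mkseq //; split.
    apply: ideal_gen_subset (gammas_in_left k) => x /mem_take.
    by rewrite !mem_cat orbC.
  by apply: ideal_gen_subset (gammas_in_right k) => x /mem_take.
move=> x [Ix Jx]; apply: (@radical_exp _ _ _ 2) => //; rewrite expr2.
apply: (ideal_gen_sub (is_ideal_colon x idK)) Ix => i _ /=.
have [_ _ KM] := idK; rewrite nth_cat; case: ltnP => _.
  by apply: KM; apply: add_in_radical.
rewrite mulrC; apply: (ideal_gen_sub (is_ideal_colon _ idK)) Jx => j _ /=.
exact: mul_in_radical.
Qed.

End Antidiagonals.

Theorem corollary1 (R : comPzRingType) (hR : noetherian R)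
  (u v : nat) (mu : u.-tuple R) (nu : v.-tuple R)
  (s : nat) (hs0 : (0 < s)%N) (hsu : (s < u)%N) (hsv : (s <= v)%N)
  (hsub : bracket_sub (take s mu) (take s nu))
  (r : nat) (hr : r = if (s + 2 <= v)%N then (u + v - s - 1)%N else u) :
  (exists2 a : nat, is_ara (ideal_gen mu `&` ideal_gen nu) a & (a <= r)%N) /\
  (exists gamma : r.-tuple R,
    [/\ gen_up_to_radical gamma (ideal_gen mu `&` ideal_gen nu),
        bracket_sub (take u gamma) (drop s mu ++ take s mu)
      & bracket_sub (take v gamma) nu]).
Proof.
have size_a : size (take s mu) = s by rewrite size_takel // size_tuple ltnW.
have size_b : size (drop s mu) = (u - s)%N by rewrite size_drop size_tuple.
have le_ur : (u <= r)%N by rewrite hr; case: ifP; lia.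
have le_vr : (v <= r)%N by rewrite hr; case: ifP; lia.
have a_nu j : ideal_gen (take j.+1 nu) (nth 0%R (take s mu) j).
  have [ltjs | lesj] := ltnP j s; last first.
    by rewrite nth_default ?size_a //; case: (is_ideal_gen (take j.+1 nu)).
  have [_ /(_ j.+1)] := hsub; rewrite size_takel ?size_tuple // ltjs => /(_ isT).
  rewrite [take j.+1 (take s nu)]take_takel //; apply.
  exact: ideal_gen_take_nth.
set a := take s mu in size_a a_nu *; set b := drop s mu in size_b *.
have gen : gen_up_to_radical (gammas a b nu r) (ideal_gen mu `&` ideal_gen nu).
  rewrite -{1}(cat_take_drop s mu); apply: gen_up_to_radical_gammas => //.
    by rewrite size_b size_tuple hr; case: ifP; lia.
  by rewrite size_b size_a subnK // ltnW.
have size_g : size (gammas a b nu r) == r by rewrite size_mkseq.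
split; first exact: (@ara_le _ _ _ (Tuple size_g)).
exists (Tuple size_g); split=> //=; apply: bracket_subP.
- by rewrite size_cat size_a size_b size_takel ?(eqP size_g) // subnK // ltnW.
- move=> k; rewrite size_cat size_a size_b (subnK (ltnW hsu)) => ltku.
  rewrite nth_take // nth_mkseq; first exact: gammas_in_left.
  exact: leq_trans ltku le_ur.
- by rewrite size_takel ?(eqP size_g) // size_tuple.
- move=> k; rewrite size_tuple => ltkv.
  rewrite nth_take // nth_mkseq; first exact: gammas_in_right.
  exact: leq_trans ltkv le_vr.
Qed.
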